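(* Let $T$ be a centralizable Hopf monad on an autonomous category $\mathcal{C}$, let $(Z_T,\partial)$ be the centralizer of $T$ and $\Omega\colon TZ_T\to Z_TT$ the canonical distributive law of $T$. Let $\widetilde{Z}_T^\Omega$ be the lift of the Hopf monad $Z_T$ to $T\text{-}\mathcal{C}$ given by $\widetilde{Z}_T^\Omega(M,r)=(Z_T(M),Z_T(r)\Omega_M)$ and $\widetilde{Z}_T^\Omega(f)=Z_T(f)$. For any $T$-modules $(M,r)$ and $(N,s)$, set $$\widetilde{\partial}_{(M,r),(N,s)}=(s\otimes\mathrm{id}_{Z_T(M)})\partial_{M,N}\colon(M,r)\otimes(N,s)\to(N,s)\otimes\widetilde{Z}_T^\Omega(M,r).$$ Then the pair $(\widetilde{Z}_T^\Omega,\widetilde{\partial})$ is a centralizer of the category $T\text{-}\mathcal{C}$.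
   Context: Categories are small and monoidal categories are strict, with product $\otimes$ and unit $\mathbf 1$. A monoidal category is autonomous if every object $X$ has a left dual ${}^\vee X$ (with $\mathrm{ev}_X\colon {}^\vee X\otimes X\to\mathbf 1$, $\mathrm{coev}_X\colon \mathbf 1\to X\otimes {}^\vee X$) and a right dual $X^\vee$ (with $\widetilde{\mathrm{ev}}_X\colon X\otimes X^\vee\to \mathbf 1$, $\widetilde{\mathrm{coev}}_X\colon \mathbf 1\to X^\vee\otimes X$). Duals are chosen; ${}^\vee f$, $f^\vee$ are dual morphisms; ${}^\vee T(X)$ means ${}^\vee(T(X))$. A comonoidal functor $F$ is a functor with a coassociative and counital natural transformation $F_2(X,Y)\colon F(X\otimes Y)\to F(X)\otimes F(Y)$, $F_0\colon F(\mathbf 1)\to\mathbf 1$; $F_3(X,Y,Z)=(\mathrm{id}\otimes F_2(Y,Z))F_2(X,Y\otimes Z)$. Comonoidal natural transformations are those compatible with these structures. A bimonad is a monad $(T,\mu,\eta)$ with a comonoidal structure on $T$ such that $\mu,\eta$ are comonoidal. A left antipode for $T$ is a natural transformation $s^l_X\colon T({}^\vee T(X))\to {}^\vee X$ with $T_0T(\mathrm{ev}_X)T({}^\vee\eta_X\otimes \mathrm{id}_X)=\mathrm{ev}_{T(X)}(s^l_{T(X)}T({}^\vee\mu_X)\otimes \mathrm{id})T_2({}^\vee T(X),X)$ and $(\eta_X\otimes \mathrm{id}_{{}^\vee X})\mathrm{coev}_XT_0=(\mu_X\otimes s^l_X)T_2(T(X),{}^\vee T(X))T(\mathrm{coev}_{T(X)})$.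 A right antipode is a natural transformation $s^r_X\colon T(T(X)^\vee)\to X^\vee$ with $T_0T(\widetilde{\mathrm{ev}}_X)T(\mathrm{id}_X\otimes\eta_X^\vee)=\widetilde{\mathrm{ev}}_{T(X)}(\mathrm{id}\otimes s^r_{T(X)}T(\mu_X^\vee))T_2(X,T(X)^\vee)$ and $(\mathrm{id}_{X^\vee}\otimes\eta_X)\widetilde{\mathrm{coev}}_XT_0=(s^r_X\otimes\mu_X)T_2(T(X)^\vee,T(X))T(\widetilde{\mathrm{coev}}_{T(X)})$. A Hopf monad is a bimonad on an autonomous category having a left and a right antipode. For a monad $T$, $T\text{-}\mathcal{C}$ is the category of $T$-modules $(M,r)$ ($r\colon T(M)\to M$, $rT(r)=r\mu_M$, $r\eta_M=\mathrm{id}_M$) and $T$-linear morphisms. If $T$ is a bimonad, it is monoidal with $(M,r)\otimes(N,s)=(M\otimes N,(r\otimes s)T_2(M,N))$ and unit $(\mathbf 1,T_0)$. A centralizer of an endofunctor $Q$ of a monoidal category $\mathcal{A}$ is a pair $(Z_Q,\partial)$ with $Z_Q$ an endofunctor of $\mathcal{A}$ and $\partial_{X,Y}\colon X\otimes Y\to Q(Y)\otimes Z_Q(X)$ natural in $X,Y$, such that for all objects $X,W$ and every natural $\{\xi_Y\colon X\otimes Y\to Q(Y)\otimes W\}_Y$ there is a unique $r\colon Z_Q(X)\to W$ with $\xi_Y=(\mathrm{id}_{Q(Y)}\otimes r)\partial_{X,Y}$ for all $Y$. $Q$ is centralizable if it has a centralizer. A centralizer of the category $\mathcal{A}$ is a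 centralizer of its identity endofunctor $1_{\mathcal{A}}$. Set $i_{X,Y}=(\mathrm{ev}_{T(Y)}\otimes\mathrm{id}_{Z_T(X)})(\mathrm{id}_{{}^\vee T(Y)}\otimes\partial_{X,Y})\colon {}^\vee T(Y)\otimes X\otimes Y\to Z_T(X)$. The canonical distributive law of $T$ is the natural transformation $\Omega\colon TZ_T\to Z_TT$ determined by $\Omega_XT(i_{X,Y})=i_{T(X),T(Y)}({}^\vee\mu_Y s^l_{T(Y)}T({}^\vee\mu_Y)\otimes\mathrm{id}_{T(X)\otimes T(Y)})T_3({}^\vee T(Y),X,Y)$ for all $X,Y$ (this determines $\Omega$ because $i_{X,-}$, hence also $T(i_{X,-})$, is a universal dinatural transformation). It is a distributive law of $T$ over $Z_T$, where $Z_T$ is a Hopf monad with the structure determined by $(\mathrm{id}\otimes m_X)(\mathrm{id}_{T(Y_1)}\otimes\partial_{Z_T(X),Y_2})(\partial_{X,Y_1}\otimes\mathrm{id}_{Y_2})=(T_2(Y_1,Y_2)\otimes\mathrm{id}_{Z_T(X)})\partial_{X,Y_1\otimes Y_2}$, $u_X=(T_0\otimes\mathrm{id}_{Z_T(X)})\partial_{X,\mathbf 1}$, $(\mathrm{id}_{T(Y)}\otimes(Z_T)_2(X_1,X_2))\partial_{X_1\otimes X_2,Y}=(\mu_Y\otimes\mathrm{id})(\partial_{X_1,T(Y)}\otimes\mathrm{id}_{Z_T(X_2)})(\mathrm{id}_{X_1}\otimes\partial_{X_2,Y})$, $(\mathrm{id}_{T(Y)}\otimes(Z_T)_0)\partial_{\mathbf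 1,Y}=\eta_Y$ ($m$, $u$ the product and unit of $Z_T$). *)

(* Defs.v *)
From Stdlib Require Import ssreflect ProofIrrelevance.

Set Implicit Arguments.
Unset Strict Implicit.
Unset Printing Implicit Defensive.

Declare Scope cat_scope.
Delimit Scope cat_scope with cat.
Local Open Scope cat_scope.

Record Category := {
  ob :> Type;
  hom : ob -> ob -> Type;
  idm : forall X : ob, hom X X;
  comp : forall X Y Z : ob, hom Y Z -> hom X Y -> hom X Z;
  comp1m : forall (X Y : ob) (f : hom X Y), comp (idm Y) f = f;
  compm1 : forall (X Y : ob) (f : hom X Y), comp f (idm X) = f;
  compA : forall (X Y Z W : ob) (h : hom Z W) (g : hom Y Z) (f : hom X Y),
    comp h (comp g f) = comp (comp h g) f
}.

Arguments hom {c} X Y.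
Arguments idm {c} X.
Arguments comp {c X Y Z} g f.
Notation "g ∘ f" := (comp g f) (at level 40, left associativity) : cat_scope.

(* The identity morphism of X, with its codomain rewritten along an equality
   of objects. *)
Definition eqhom (C : Category) (X Y : C) (e : X = Y) : hom X Y :=
  match e in _ = Y' return hom X Y' with eq_refl => idm X end.

Record Functor (C D : Category) := {
  fobj :> C -> D;
  fmap : forall X Y : C, hom X Y -> hom (fobj X) (fobj Y);
  fmap1 : forall X : C, fmap (idm X) = idm (fobj X);
  fmapM : forall (X Y Z : C) (g : hom Y Z) (f : hom X Y),
    fmap (g ∘ f) = fmap g ∘ fmap f
}.

Arguments fmap {C D} F {X Y} f : rename.

Definition fid (C : Category) : Functor C C :=
  @Build_Functor C C (fun X => X) (fun _ _ f => f)
    (fun _ => eq_refl) (fun _ _ _ _ _ => eq_refl).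

Lemma fcomp_map1 (C D E : Category) (G : Functor D E) (F : Functor C D) (X : C) :
  fmap G (fmap F (idm X)) = idm (G (F X)).
Proof. by rewrite !fmap1. Qed.

Lemma fcomp_mapM (C D E : Category) (G : Functor D E) (F : Functor C D)
    (X Y Z : C) (g : hom Y Z) (f : hom X Y) :
  fmap G (fmap F (g ∘ f)) = fmap G (fmap F g) ∘ fmap G (fmap F f).
Proof. by rewrite !fmapM. Qed.

Definition fcomp (C D E : Category) (G : Functor D E) (F : Functor C D) :
    Functor C E :=
  @Build_Functor C E (fun X => G (F X)) (fun _ _ f => fmap G (fmap F f))
    (fcomp_map1 G F) (@fcomp_mapM C D E G F).

Record NatTrans (C D : Category) (F G : Functor C D) := {
  ncomp :> forall X : C, hom (F X) (G X);
  natural : forall (X Y : C) (f : hom X Y), fmap G f ∘ ncomp X = ncomp Y ∘ fmap F f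
}.

(* The object equalities are propositional, so the strictness equations between
   morphisms are stated up to the transport morphisms [eqhom]. *)
Record MonoidalCategory := {
  mcat :> Category;
  tens : mcat -> mcat -> mcat;
  tensm : forall X X' Y Y' : mcat,
    hom X X' -> hom Y Y' -> hom (tens X Y) (tens X' Y');
  one : mcat;
  tensm1 : forall X Y : mcat, tensm (idm X) (idm Y) = idm (tens X Y);
  tensmM : forall (X X' X'' Y Y' Y'' : mcat) (f' : hom X' X'') (f : hom X X')
      (g' : hom Y' Y'') (g : hom Y Y'),
    tensm (f' ∘ f) (g' ∘ g) = tensm f' g' ∘ tensm f g;
  assoc_ob : forall X Y Z : mcat, tens (tens X Y) Z = tens X (tens Y Z);
  lunit_ob : forall X : mcat, tens one X = X;
  runit_ob : forall X : mcat, tens X one = X;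
  assoc_mor : forall (X X' Y Y' Z Z' : mcat)
      (f : hom X X') (g : hom Y Y') (h : hom Z Z'),
    eqhom (assoc_ob X' Y' Z') ∘ tensm (tensm f g) h
    = tensm f (tensm g h) ∘ eqhom (assoc_ob X Y Z);
  lunit_mor : forall (X X' : mcat) (f : hom X X'),
    eqhom (lunit_ob X') ∘ tensm (idm one) f = f ∘ eqhom (lunit_ob X);
  runit_mor : forall (X X' : mcat) (f : hom X X'),
    eqhom (runit_ob X') ∘ tensm f (idm one) = f ∘ eqhom (runit_ob X)
}.

Arguments tens {m} X Y.
Arguments tensm {m X X' Y Y'} f g.
Arguments one {m}.
Notation "X ⊗ Y" := (tens X Y) (at level 35, right associativity) : cat_scope.
Notation "f ⊗' g" := (tensm f g) (at level 35, right associativity) : cat_scope.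
Notation "𝟏" := one : cat_scope.

Section Strictness.
Variable A : MonoidalCategory.
Implicit Types X Y Z : A.

Definition assoc X Y Z : hom ((X ⊗ Y) ⊗ Z) (X ⊗ (Y ⊗ Z)) :=
  eqhom (assoc_ob X Y Z).
Definition assocV X Y Z : hom (X ⊗ (Y ⊗ Z)) ((X ⊗ Y) ⊗ Z) :=
  eqhom (eq_sym (assoc_ob X Y Z)).
Definition lunit X : hom (𝟏 ⊗ X) X := eqhom (lunit_ob X).
Definition lunitV X : hom X (𝟏 ⊗ X) := eqhom (eq_sym (lunit_ob X)).
Definition runit X : hom (X ⊗ 𝟏) X := eqhom (runit_ob X).
Definition runitV X : hom X (X ⊗ 𝟏) := eqhom (eq_sym (runit_ob X)).

End Strictness.

Record AutonomousCategory := {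
  acat :> MonoidalCategory;
  ldual : acat -> acat;
  lev : forall X : acat, hom (ldual X ⊗ X) 𝟏;
  lcoev : forall X : acat, hom 𝟏 (X ⊗ ldual X);
  lzigzag : forall X : acat,
    runit X ∘ (idm X ⊗' lev X) ∘ assoc X (ldual X) X
      ∘ (lcoev X ⊗' idm X) ∘ lunitV X = idm X;
  lzagzig : forall X : acat,
    lunit (ldual X) ∘ (lev X ⊗' idm (ldual X)) ∘ assocV (ldual X) X (ldual X)
      ∘ (idm (ldual X) ⊗' lcoev X) ∘ runitV (ldual X) = idm (ldual X);
  rdual : acat -> acat;
  rev : forall X : acat, hom (X ⊗ rdual X) 𝟏;
  rcoev : forall X : acat, hom 𝟏 (rdual X ⊗ X);
  rzigzag : forall X : acat,
    lunit X ∘ (rev X ⊗' idm X) ∘ assocV X (rdual X) X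
      ∘ (idm X ⊗' rcoev X) ∘ runitV X = idm X;
  rzagzig : forall X : acat,
    runit (rdual X) ∘ (idm (rdual X) ⊗' rev X) ∘ assoc (rdual X) X (rdual X)
      ∘ (rcoev X ⊗' idm (rdual X)) ∘ lunitV (rdual X) = idm (rdual X)
}.

Definition ldualm (C : AutonomousCategory) (X Y : C) (f : hom X Y) :
    hom (ldual Y) (ldual X) :=
  lunit (ldual X) ∘ (lev Y ⊗' idm (ldual X)) ∘ assocV (ldual Y) Y (ldual X)
    ∘ (idm (ldual Y) ⊗' (f ⊗' idm (ldual X))) ∘ (idm (ldual Y) ⊗' lcoev X)
    ∘ runitV (ldual Y).

Definition rdualm (C : AutonomousCategory) (X Y : C) (f : hom X Y) :
    hom (rdual Y) (rdual X) :=
  runit (rdual X) ∘ (idm (rdual X) ⊗' rev Y) ∘ assoc (rdual X) Y (rdual Y)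
    ∘ ((idm (rdual X) ⊗' f) ⊗' idm (rdual Y)) ∘ (rcoev X ⊗' idm (rdual Y))
    ∘ lunitV (rdual Y).

Record Comonoidal (A B : MonoidalCategory) (F : Functor A B) := {
  com2 : forall X Y : A, hom (F (X ⊗ Y)) (F X ⊗ F Y);
  com0 : hom (F 𝟏) 𝟏;
  com2_natural : forall (X X' Y Y' : A) (f : hom X X') (g : hom Y Y'),
    (fmap F f ⊗' fmap F g) ∘ com2 X Y = com2 X' Y' ∘ fmap F (f ⊗' g);
  com2_coassoc : forall X Y Z : A,
    assoc (F X) (F Y) (F Z) ∘ (com2 X Y ⊗' idm (F Z)) ∘ com2 (X ⊗ Y) Z
    = (idm (F X) ⊗' com2 Y Z) ∘ com2 X (Y ⊗ Z) ∘ fmap F (assoc X Y Z);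
  com2_counitl : forall X : A,
    lunit (F X) ∘ (com0 ⊗' idm (F X)) ∘ com2 𝟏 X = fmap F (lunit X);
  com2_counitr : forall X : A,
    runit (F X) ∘ (idm (F X) ⊗' com0) ∘ com2 X 𝟏 = fmap F (runit X)
}.

Arguments com2 {A B F} c X Y.
Arguments com0 {A B F} c.

Definition com3 (A B : MonoidalCategory) (F : Functor A B) (c : Comonoidal F)
    (X Y Z : A) : hom (F (X ⊗ Y ⊗ Z)) (F X ⊗ F Y ⊗ F Z) :=
  (idm (F X) ⊗' com2 c Y Z) ∘ com2 c X (Y ⊗ Z).

Record Monad (C : Category) := {
  mfun :> Functor C C;
  mmul : NatTrans (fcomp mfun mfun) mfun;
  munit : NatTrans (fid C) mfun;
  mmulA : forall X : C, mmul X ∘ fmap mfun (mmul X) = mmul X ∘ mmul (mfun X);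
  mmul1 : forall X : C, mmul X ∘ munit (mfun X) = idm (mfun X);
  m1mul : forall X : C, mmul X ∘ fmap mfun (munit X) = idm (mfun X)
}.

Arguments mmul {C} m.
Arguments munit {C} m.

(* The last four equations say that the product and the unit are comonoidal,
   where T T carries the structure T_2(TX,TY) T(T_2(X,Y)), T_0 T(T_0). *)
Record Bimonad (C : MonoidalCategory) := {
  bmonad :> Monad C;
  bcom : Comonoidal bmonad;
  mmul_com2 : forall X Y : C,
    (mmul bmonad X ⊗' mmul bmonad Y)
      ∘ (com2 bcom (bmonad X) (bmonad Y) ∘ fmap bmonad (com2 bcom X Y))
    = com2 bcom X Y ∘ mmul bmonad (X ⊗ Y);
  mmul_com0 : com0 bcom ∘ fmap bmonad (com0 bcom) = com0 bcom ∘ mmul bmonad 𝟏;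
  munit_com2 : forall X Y : C,
    munit bmonad X ⊗' munit bmonad Y = com2 bcom X Y ∘ munit bmonad (X ⊗ Y);
  munit_com0 : com0 bcom ∘ munit bmonad 𝟏 = idm 𝟏
}.

Arguments bcom {C} b.

Record LeftAntipode (C : AutonomousCategory) (T : Bimonad C) := {
  lant :> forall X : C, hom (T (ldual (T X))) (ldual X);
  lant_natural : forall (X Y : C) (f : hom X Y),
    ldualm f ∘ lant Y = lant X ∘ fmap T (ldualm (fmap T f));
  lant_ev : forall X : C,
    com0 (bcom T) ∘ fmap T (lev X) ∘ fmap T (ldualm (munit T X) ⊗' idm X)
    = lev (T X) ∘ ((lant (T X) ∘ fmap T (ldualm (mmul T X))) ⊗' idm (T X))
        ∘ com2 (bcom T) (ldual (T X)) X;
  lant_coev : forall X : C,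
    (munit T X ⊗' idm (ldual X)) ∘ lcoev X ∘ com0 (bcom T)
    = (mmul T X ⊗' lant X) ∘ com2 (bcom T) (T X) (ldual (T X))
        ∘ fmap T (lcoev (T X))
}.

Record RightAntipode (C : AutonomousCategory) (T : Bimonad C) := {
  rant :> forall X : C, hom (T (rdual (T X))) (rdual X);
  rant_natural : forall (X Y : C) (f : hom X Y),
    rdualm f ∘ rant Y = rant X ∘ fmap T (rdualm (fmap T f));
  rant_ev : forall X : C,
    com0 (bcom T) ∘ fmap T (rev X) ∘ fmap T (idm X ⊗' rdualm (munit T X))
    = rev (T X) ∘ (idm (T X) ⊗' (rant (T X) ∘ fmap T (rdualm (mmul T X))))
        ∘ com2 (bcom T) X (rdual (T X));
  rant_coev : forall X : C,
    (idm (rdual X) ⊗' munit T X) ∘ rcoev X ∘ com0 (bcom T)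
    = (rant X ⊗' mmul T X) ∘ com2 (bcom T) (rdual (T X)) (T X)
        ∘ fmap T (rcoev (T X))
}.

Record HopfMonad (C : AutonomousCategory) := {
  hbimonad :> Bimonad C;
  sl : LeftAntipode hbimonad;
  sr : RightAntipode hbimonad
}.

Arguments sl {C} h.
Arguments sr {C} h.

Definition is_action (C : Category) (T : Monad C) (M : C) (r : hom (T M) M) : Prop :=
  r ∘ fmap T r = r ∘ mmul T M /\ r ∘ munit T M = idm M.

Record Module (C : Category) (T : Monad C) := {
  carrier :> C;
  act : hom (T carrier) carrier;
  actP : is_action act
}.

Arguments act {C T} m.

Definition is_linear (C : Category) (T : Monad C) (M N : Module T)
    (f : hom M N) : Prop :=
  f ∘ act M = act N ∘ fmap T f.

Record Linear (C : Category) (T : Monad C) (M N : Module T) := {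
  lmap :> hom M N;
  lmapP : is_linear lmap
}.

Lemma Linear_eq (C : Category) (T : Monad C) (M N : Module T) (f g : Linear M N) :
  lmap f = lmap g -> f = g.
Proof.
case: f g => [f Hf] [g Hg] /= e; subst g.
by congr Build_Linear; apply: proof_irrelevance.
Qed.

Section ModuleCategory.
Variables (C : Category) (T : Monad C).

Lemma linear_id (M : Module T) : @is_linear C T M M (idm M).
Proof. by rewrite /is_linear fmap1 comp1m compm1. Qed.

Lemma linear_comp (M N P : Module T) (g : Linear N P) (f : Linear M N) :
  @is_linear C T M P (g ∘ f).
Proof. by rewrite /is_linear -compA (lmapP f) compA (lmapP g) fmapM compA. Qed.

Definition ModuleCategory : Category.
Proof.
refine (@Build_Category (Module T) (@Linear C T)
  (fun M => Build_Linear (linear_id M))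
  (fun M N P g f => Build_Linear (linear_comp g f)) _ _ _).
- by move=> *; apply/Linear_eq/comp1m.
- by move=> *; apply/Linear_eq/compm1.
- by move=> *; apply/Linear_eq/compA.
Defined.

Lemma lmap_eqhom (M N : Module T) (e : M = N) (e' : carrier M = carrier N) :
  lmap (@eqhom ModuleCategory M N e) = eqhom e'.
Proof. by destruct e; rewrite (proof_irrelevance _ e' eq_refl). Qed.

Lemma Module_eq (M N : Module T) (e : carrier M = carrier N) :
  eqhom e ∘ act M = act N ∘ fmap T (eqhom e) -> M = N.
Proof.
case: M N e => [M r Hr] [N s Hs] /= e; destruct e => /=.
rewrite comp1m fmap1 compm1 => e; subst s.
by congr Build_Module; apply: proof_irrelevance.
Qed.

End ModuleCategory.

Section ModuleMonoidal.
Variables (C : MonoidalCategory) (T : Bimonad C).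
Implicit Types M N P : Module T.

Definition tens_act M N : hom (T (M ⊗ N)) (M ⊗ N) :=
  (act M ⊗' act N) ∘ com2 (bcom T) M N.

Lemma tens_actP M N : is_action (tens_act M N).
Proof.
case: (actP M) (actP N) => [M2 M1] [N2 N1]; rewrite /tens_act; split.
- rewrite fmapM compA -(compA _ (com2 _ _ _) (fmap T (_ ⊗' _))) -com2_natural.
  by rewrite compA -tensmM M2 N2 tensmM -!compA mmul_com2.
- by rewrite -compA -munit_com2 -tensmM M1 N1 tensm1.
Qed.

Definition tens_mod M N : Module T := Build_Module (tens_actP M N).

Lemma one_actP : is_action (com0 (bcom T)).
Proof. by split; [apply: mmul_com0 | apply: munit_com0]. Qed.

Definition one_mod : Module T := Build_Module one_actP.

Lemma tens_linear M M' N N' (f : Linear M M') (g : Linear N N') :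
  @is_linear C T (tens_mod M N) (tens_mod M' N') (f ⊗' g).
Proof.
rewrite /is_linear /= /tens_act.
by rewrite compA -tensmM (lmapP f) (lmapP g) tensmM -!compA com2_natural.
Qed.

Lemma assoc_mod M N P : tens_mod (tens_mod M N) P = tens_mod M (tens_mod N P).
Proof.
apply: (@Module_eq _ _ (tens_mod (tens_mod M N) P) (tens_mod M (tens_mod N P))
          (assoc_ob (carrier M) N P)).
have H := com2_coassoc (bcom T) M N P; rewrite /assoc in H.
rewrite /= /tens_act /= /tens_act.
rewrite -{1}(compm1 (act P)) -{2}(compm1 (act M)) !tensmM.
rewrite compA (compA (eqhom _)) assoc_mor -!compA; congr (_ ∘ _).
by rewrite compA H !compA.
Qed.

Lemma lunit_mod M : tens_mod one_mod M = M.
Proof.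
apply: (@Module_eq _ _ (tens_mod one_mod M) M (lunit_ob (carrier M))).
have H := com2_counitl (bcom T) M; rewrite /lunit in H.
rewrite /= /tens_act /= -H !compA -lunit_mor -(compA _ _ (com0 _ ⊗' _)).
by rewrite -tensmM comp1m compm1.
Qed.

Lemma runit_mod M : tens_mod M one_mod = M.
Proof.
apply: (@Module_eq _ _ (tens_mod M one_mod) M (runit_ob (carrier M))).
have H := com2_counitr (bcom T) M; rewrite /runit in H.
rewrite /= /tens_act /= -H !compA -runit_mor -(compA _ _ (_ ⊗' com0 _)).
by rewrite -tensmM comp1m compm1.
Qed.

Definition ModuleMonoidal : MonoidalCategory.
Proof.
refine (@Build_MonoidalCategory (ModuleCategory T) tens_mod
  (fun M M' N N' f g => Build_Linear (tens_linear f g)) one_mod _ _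
  assoc_mod lunit_mod runit_mod _ _ _).
- by move=> *; apply/Linear_eq/tensm1.
- by move=> *; apply/Linear_eq/tensmM.
- move=> X X' Y Y' Z Z' f g h; apply: Linear_eq => /=.
  rewrite (@lmap_eqhom C T _ _ (assoc_mod X Y Z)
             (@assoc_ob C (carrier X) (carrier Y) (carrier Z))).
  rewrite (@lmap_eqhom C T _ _ (assoc_mod X' Y' Z')
             (@assoc_ob C (carrier X') (carrier Y') (carrier Z'))).
  exact: assoc_mor.
- move=> X X' f; apply: Linear_eq => /=.
  rewrite (@lmap_eqhom C T _ _ (lunit_mod X)
             (@lunit_ob C (carrier X))).
  rewrite (@lmap_eqhom C T _ _ (lunit_mod X')
             (@lunit_ob C (carrier X'))).
  exact: lunit_mor.
- move=> X X' f; apply: Linear_eq => /=.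
  rewrite (@lmap_eqhom C T _ _ (runit_mod X)
             (@runit_ob C (carrier X))).
  rewrite (@lmap_eqhom C T _ _ (runit_mod X')
             (@runit_ob C (carrier X'))).
  exact: runit_mor.
Defined.

End ModuleMonoidal.

Record is_centralizer (A : MonoidalCategory) (Q Z : Functor A A)
    (d : forall X Y : A, hom (X ⊗ Y) (Q Y ⊗ Z X)) : Prop := {
  centralizer_natural : forall (X X' Y Y' : A) (f : hom X X') (g : hom Y Y'),
    (fmap Q g ⊗' fmap Z f) ∘ d X Y = d X' Y' ∘ (f ⊗' g);
  centralizer_universal : forall (X W : A) (xi : forall Y : A, hom (X ⊗ Y) (Q Y ⊗ W)),
    (forall (Y Y' : A) (g : hom Y Y'),
       (fmap Q g ⊗' idm W) ∘ xi Y = xi Y' ∘ (idm X ⊗' g)) ->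
    exists! r : hom (Z X) W, forall Y : A, xi Y = (idm (Q Y) ⊗' r) ∘ d X Y
}.

Definition is_category_centralizer (A : MonoidalCategory) (Z : Functor A A)
    (d : forall X Y : A, hom (X ⊗ Y) (Y ⊗ Z X)) : Prop :=
  @is_centralizer A (fid A) Z d.

Section CanonicalLaw.
Variables (C : AutonomousCategory) (T : HopfMonad C) (Z : Functor C C).
Variable d : forall X Y : C, hom (X ⊗ Y) (T Y ⊗ Z X).

(* The mate of d(X,Y) under the duality of T Y: the universal dinatural
   transformation, in Y, that presents Z X as a coend. *)
Definition univ_dinat (X Y : C) : hom (ldual (T Y) ⊗ X ⊗ Y) (Z X) :=
  lunit (Z X) ∘ (lev (T Y) ⊗' idm (Z X)) ∘ assocV (ldual (T Y)) (T Y) (Z X)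
    ∘ (idm (ldual (T Y)) ⊗' d X Y).

(* Since the T(univ_dinat X -) are jointly epic, this determines Om. *)
Definition is_canonical_law (Om : NatTrans (fcomp T Z) (fcomp Z T)) : Prop :=
  forall X Y : C,
    Om X ∘ fmap T (univ_dinat X Y)
    = univ_dinat (T X) (T Y)
        ∘ ((ldualm (mmul T Y) ∘ sl T (T Y) ∘ fmap T (ldualm (mmul T Y)))
             ⊗' idm (T X ⊗ T Y))
        ∘ com3 (bcom T) (ldual (T Y)) X Y.

End CanonicalLaw.

Section Lift.
Variables (C : MonoidalCategory) (T : Bimonad C) (Z : Functor C C).
Variable Om : NatTrans (fcomp T Z) (fcomp Z T).

Definition lift_act (M : Module T) : hom (T (Z M)) (Z M) := fmap Z (act M) ∘ Om M.

(* This holds when Om is a distributive law of T over Z: it follows from the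
   axioms relating Om to the product and the unit of T. *)
Hypothesis HM : forall M : Module T, is_action (lift_act M).

Definition lift_mod (M : Module T) : Module T := Build_Module (HM M).

Lemma lift_linear (M N : Module T) (f : Linear M N) :
  @is_linear C T (lift_mod M) (lift_mod N) (fmap Z f).
Proof.
rewrite /is_linear /= /lift_act compA -fmapM (lmapP f) fmapM -!compA.
by congr (_ ∘ _); apply: (natural Om f).
Qed.

Definition lift : Functor (ModuleMonoidal T) (ModuleMonoidal T).
Proof.
refine (@Build_Functor (ModuleMonoidal T) (ModuleMonoidal T) lift_mod
  (fun M N f => Build_Linear (lift_linear f)) _ _).
- by move=> *; apply/Linear_eq/fmap1.
- by move=> *; apply/Linear_eq/fmapM.
Defined.

Variable d : forall X Y : C, hom (X ⊗ Y) (T Y ⊗ Z X).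

Definition lift_d (M N : Module T) : hom (M ⊗ N) (N ⊗ Z M) :=
  (act N ⊗' idm (Z M)) ∘ d M N.

Definition lift_d_linear : Prop :=
  forall M N : Module T,
    @is_linear C T (tens_mod M N) (tens_mod N (lift_mod M)) (lift_d M N).

Definition lift_d_mor (HL : lift_d_linear) (M N : ModuleMonoidal T) :
    hom (M ⊗ N) (N ⊗ lift M) :=
  Build_Linear (HL M N).

End Lift.

(* Main.v *)
(** Transposing the law along the duality of [T Y] gives
      (μ_Y ⊗ Ω_X) T_2(TY, ZX) T(∂_{X,Y}) = (μ_Y ⊗ id) ∂_{TX,TY} T_2(X, Y),
    and the T-linearity of ∂~ is immediate from this form.  The axioms of the
    action on [Z M] and the linearity of the universal factorization are equations
    between morphisms out of [T (Z M)] or [T (T (Z M))], whereas ∂ only detects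
    morphisms out of [Z M].  To detect the former, note that the fusion operator
    T(M ⊗ V) → M ⊗ TV of a module [M] is inverted by the right antipode, so that
    P : M ⊗ V → U, with [U] a module, has a linear transpose M ⊗ TV → U.  For
    M = TX, the left antipode recovers [P] from the restriction of its transpose to
    X ⊗ TV.  Hence if morphisms X ⊗ V → U are detected by maps D_N → N ⊗ X, with
    [N] running over the modules, then morphisms TX ⊗ V → U are detected by the
    induced maps T(D_N) → T(N ⊗ X) → N ⊗ TX. *)

Require Import Defs.
From Stdlib Require Import ssreflect ProofIrrelevance ClassicalEpsilon.
Set Implicit Arguments.
Unset Strict Implicit.
Unset Printing Implicit Defensive.
Local Open Scope cat_scope.

(** * Packed arrows *)

(* The monoidal structure is strict only up to [eqhom].  Packing a morphism with its
   source and target turns [eqhom] into an identity and makes composition and tensor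
   strictly associative for Leibniz equality.  The body [None] marks a composite of
   arrows that do not match; [src] and [tgt] compute in all cases. *)
Record arrow (C : Category) := Arrow {
  src : C; tgt : C; body : option (hom src tgt)
}.

Definition arr (C : Category) (X Y : C) (f : hom X Y) : arrow C := Arrow (Some f).
Notation "⌈ f ⌉" := (arr f) (at level 0, format "⌈ f ⌉").
Notation "'ι' X" := (arr (idm X)) (at level 8, X at level 8).

Definition acomp (C : Category) (b a : arrow C) : arrow C :=
  @Arrow C (src a) (tgt b)
    match body a, body b, excluded_middle_informative (tgt a = src b) with
    | Some f, Some g, left e => Some (g ∘ eqhom e ∘ f)
    | _, _, _ => None
    end.
Notation "b • a" := (acomp b a) (at level 40, left associativity).

Definition amap (C D : Category) (F : Functor C D) (a : arrow C) : arrow D :=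
  @Arrow D (F (src a)) (F (tgt a))
    match body a with Some f => Some (fmap F f) | None => None end.

Definition atens (C : MonoidalCategory) (a b : arrow C) : arrow C :=
  @Arrow C (src a ⊗ src b) (tgt a ⊗ tgt b)
    match body a, body b with
    | Some f, Some g => Some (f ⊗' g)
    | _, _ => None
    end.
Notation "a ⊠ b" := (atens a b) (at level 35, right associativity).

(** After the case split, proof irrelevance replaces the equality proof by [eq_refl] when both
    objects are convertible, so that [eqhom] reduces. *)
Ltac em := match goal with |- context [excluded_middle_informative ?P] =>
  let e := fresh "e" in
  destruct (excluded_middle_informative P) as [e|e] => //=;
  try (rewrite (proof_irrelevance _ e eq_refl) /=) end.

Section ArrowCalculus.
Variable C : Category.
Implicit Types X Y Z : C.
Implicit Types a b c : arrow C.

(** Injection would only yield an equality of dependent pairs. Instead, the body of any arrow equal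
    to [⌈f⌉] is described as a transport of [f]; at [⌈g⌉] the transports are identities. *)
Lemma arr_inj X Y (f g : hom X Y) : ⌈f⌉ = ⌈g⌉ -> f = g.
Proof.
move=> e.
have H (a : arrow C) : ⌈f⌉ = a -> forall (eX : src a = X) (eY : tgt a = Y),
    body a = Some (eqhom (eq_sym eY) ∘ f ∘ eqhom eX).
  move=> <- /= eX eY; rewrite (proof_irrelevance _ eX eq_refl).
  by rewrite (proof_irrelevance _ eY eq_refl) /= comp1m compm1.
have := H _ e eq_refl eq_refl; rewrite /= comp1m compm1.
by case=> ->.
Qed.

Lemma arr_eqhom X Y (e : X = Y) : ⌈eqhom e⌉ = ι Y.
Proof. by destruct e. Qed.

Lemma arr_comp X Y Z (g : hom Y Z) (f : hom X Y) : ⌈g ∘ f⌉ = ⌈g⌉ • ⌈f⌉.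
Proof.
rewrite /acomp /=; em => //.
by rewrite compm1.
Qed.

Lemma acompA a b c : c • (b • a) = c • b • a.
Proof.
case: a b c => [X Y [f|]] [Y' Z [g|]] [Z' W [h|]]; rewrite /acomp /=;
  repeat em; rewrite ?compA //.
Qed.

Lemma acomp1a X a : tgt a = X -> ι X • a = a.
Proof.
case: a => [Y Z [f|]] /= <-; rewrite /acomp /=; repeat em; rewrite // !comp1m //.
Qed.

Lemma acompa1 X a : src a = X -> a • ι X = a.
Proof.
case: a => [Y Z [f|]] /= <-; rewrite /acomp /=; repeat em; rewrite // !compm1 //.
Qed.

(** The matching hypothesis is essential: [F] may identify distinct objects, so images of arrows
    that do not match can become composable. Tensor products behave likewise in [atens_comp]. *)
Lemma amap_comp (D : Category) (F : Functor C D) a b :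
  tgt a = src b -> amap F (b • a) = amap F b • amap F a.
Proof.
case: a b => [X Y [f|]] [Y' Z [g|]] /= e; destruct e; rewrite /acomp /amap //=;
  repeat em; rewrite // !fmapM fmap1 //.
Qed.

Lemma amap1 (D : Category) (F : Functor C D) X : amap F (ι X) = ι (F X).
Proof. by rewrite /amap /= fmap1. Qed.

Lemma amap_arr (D : Category) (F : Functor C D) X Y (f : hom X Y) :
  ⌈fmap F f⌉ = amap F ⌈f⌉.
Proof. by []. Qed.

End ArrowCalculus.

(** * Strict tensor calculus of packed arrows *)

Section MonoidalArrowCalculus.
Variable C : MonoidalCategory.
Implicit Types X Y Z : C.
Implicit Types a b c d : arrow C.

Lemma arr_tens X X' Y Y' (f : hom X X') (g : hom Y Y') : ⌈f ⊗' g⌉ = ⌈f⌉ ⊠ ⌈g⌉.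
Proof. by []. Qed.

Lemma atens1 X Y : ι X ⊠ ι Y = ι (X ⊗ Y).
Proof. by rewrite -arr_tens tensm1. Qed.

Lemma atens_comp a b c d : tgt a = src b -> tgt c = src d ->
  (b • a) ⊠ (d • c) = (b ⊠ d) • (a ⊠ c).
Proof.
case: a b c d => [X Y [f|]] [Y' Z [g|]] [U V [h|]] [V' W [k|]] /= e1 e2;
  destruct e1, e2; rewrite /acomp /atens //=; repeat em; rewrite // !compm1 tensmM //.
Qed.

(** On actual morphisms, the identity of the target is inserted as a packed [eqhom], carried across
    by [assoc_mor] and absorbed at the source. *)
Lemma atensA a b c : (a ⊠ b) ⊠ c = a ⊠ (b ⊠ c).
Proof.
case: a b c => [X X' [f|]] [Y Y' [g|]] [Z Z' [h|]];
  rewrite /atens /= ?assoc_ob //.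
rewrite -[LHS]/⌈(f ⊗' g) ⊗' h⌉ -[RHS]/⌈f ⊗' g ⊗' h⌉.
rewrite -(@acomp1a _ _ ⌈(f ⊗' g) ⊗' h⌉ (assoc_ob X' Y' Z')).
rewrite -(arr_eqhom (assoc_ob X' Y' Z')).
by rewrite -arr_comp assoc_mor arr_comp arr_eqhom acompa1.
Qed.

Lemma atens1a a : ι 𝟏 ⊠ a = a.
Proof.
case: a => [X Y [f|]]; rewrite /atens /= ?lunit_ob //.
rewrite -[LHS]/⌈idm 𝟏 ⊗' f⌉ -[RHS]/⌈f⌉.
rewrite -(@acomp1a _ _ ⌈idm 𝟏 ⊗' f⌉ (lunit_ob Y)) -(arr_eqhom (lunit_ob Y)).
by rewrite -arr_comp lunit_mor arr_comp arr_eqhom acompa1.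
Qed.

Lemma atensa1 a : a ⊠ ι 𝟏 = a.
Proof.
case: a => [X Y [f|]]; rewrite /atens /= ?runit_ob //.
rewrite -[LHS]/⌈f ⊗' idm 𝟏⌉ -[RHS]/⌈f⌉.
rewrite -(@acomp1a _ _ ⌈f ⊗' idm 𝟏⌉ (runit_ob Y)) -(arr_eqhom (runit_ob Y)).
by rewrite -arr_comp runit_mor arr_comp arr_eqhom acompa1.
Qed.

Lemma whiskl X a b : tgt a = src b -> ι X ⊠ (b • a) = (ι X ⊠ b) • (ι X ⊠ a).
Proof. by move=> e; rewrite -atens_comp // acomp1a. Qed.

Lemma whiskr X a b : tgt a = src b -> (b • a) ⊠ ι X = (b ⊠ ι X) • (a ⊠ ι X).
Proof. by move=> e; rewrite -atens_comp // acomp1a. Qed.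

Lemma atens_lr X Y a b : X = src a -> Y = tgt b -> (a ⊠ ι Y) • (ι X ⊠ b) = a ⊠ b.
Proof. by move=> -> ->; rewrite -atens_comp // acomp1a // acompa1. Qed.

Lemma atens_rl X Y a b : X = tgt a -> Y = src b -> (ι X ⊠ b) • (a ⊠ ι Y) = a ⊠ b.
Proof. by move=> -> ->; rewrite -atens_comp // acomp1a // acompa1. Qed.

End MonoidalArrowCalculus.

Ltac ob := by rewrite /= ?assoc_ob ?lunit_ob ?runit_ob.

(** * Duality *)

Section Duality.
Variable C : AutonomousCategory.
Implicit Types X Y V : C.

Definition unpack := (arr_comp, arr_tens, arr_eqhom).

Lemma lzigzag_arr X : (ι X ⊠ ⌈lev X⌉) • (⌈lcoev X⌉ ⊠ ι X) = ι X.
Proof.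
have := f_equal (@arr _ _ _) (lzigzag X); rewrite !unpack.
rewrite acompa1 1?acomp1a; try ob. by rewrite acompa1; try ob.
Qed.

Lemma rzigzag_arr X : (⌈rev X⌉ ⊠ ι X) • (ι X ⊠ ⌈rcoev X⌉) = ι X.
Proof.
have := f_equal (@arr _ _ _) (rzigzag X); rewrite !unpack.
rewrite acompa1 1?acomp1a; try ob. by rewrite acompa1; try ob.
Qed.

Lemma rzagzig_arr X :
  (ι (rdual X) ⊠ ⌈rev X⌉) • (⌈rcoev X⌉ ⊠ ι (rdual X)) = ι (rdual X).
Proof.
have := f_equal (@arr _ _ _) (rzagzig X); rewrite !unpack.
rewrite acompa1 1?acomp1a; try ob. by rewrite acompa1; try ob.
Qed.

Lemma ldualm_arr X Y (f : hom X Y) :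
  ⌈ldualm f⌉ = (⌈lev Y⌉ ⊠ ι (ldual X))
     • (ι (ldual Y) ⊠ ((⌈f⌉ ⊠ ι (ldual X)) • ⌈lcoev X⌉)).
Proof.
rewrite /ldualm !unpack acompa1; try ob. rewrite acomp1a; try ob.
by rewrite acompa1 ?whiskl ?acompA; try ob.
Qed.

Lemma rdualm_arr X Y (f : hom X Y) :
  ⌈rdualm f⌉ = (ι (rdual X) ⊠ ⌈rev Y⌉)
     • (((ι (rdual X) ⊠ ⌈f⌉) • ⌈rcoev X⌉) ⊠ ι (rdual Y)).
Proof.
rewrite /rdualm !unpack acompa1; try ob. rewrite acomp1a; try ob.
by rewrite acompa1 ?whiskr ?acompA; try ob.
Qed.

(** Both sides equal [a ⊠ b], because the common source is a strict unit. *)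
Lemma unit_swap X Y (a b : arrow C) :
  src a = 𝟏 -> src b = 𝟏 -> X = tgt a -> Y = tgt b ->
  (ι X ⊠ b) • a = (a ⊠ ι Y) • b.
Proof.
move=> ea eb eX eY.
by rewrite -{1}(atensa1 a) -{2}(atens1a b) atens_rl // atens_lr.
Qed.

(** Unfolding [ldualm f] produces a second coevaluation; sliding it past [lcoev Y] by [unit_swap]
    exposes a zigzag for [Y]. *)
Lemma lcoev_dinatural X Y (f : hom X Y) :
  (ι Y ⊠ ⌈ldualm f⌉) • ⌈lcoev Y⌉ = (⌈f⌉ ⊠ ι (ldual X)) • ⌈lcoev X⌉.
Proof.
rewrite ldualm_arr; set c := _ • ⌈lcoev X⌉.
rewrite whiskl; first by ob.
rewrite -!atensA atens1 -acompA (@unit_swap _ (Y ⊗ ldual X)) //.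
rewrite acompA -atens1 -atensA -whiskr; first by ob.
by rewrite lzigzag_arr atens1 acomp1a.
Qed.

Lemma rcoev_dinatural X Y (f : hom X Y) :
  (⌈rdualm f⌉ ⊠ ι Y) • ⌈rcoev Y⌉ = (ι (rdual X) ⊠ ⌈f⌉) • ⌈rcoev X⌉.
Proof.
rewrite rdualm_arr; set c := _ • ⌈rcoev X⌉.
rewrite whiskr; first by ob.
rewrite !atensA atens1 -acompA -(@unit_swap (rdual X ⊗ Y)) //.
rewrite acompA -atens1 atensA -whiskl; first by ob.
by rewrite rzigzag_arr atens1 acomp1a.
Qed.

Lemma counit_swap X Y (a b : arrow C) :
  tgt a = 𝟏 -> tgt b = 𝟏 -> X = src a -> Y = src b ->
  a • (ι X ⊠ b) = b • (a ⊠ ι Y).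
Proof.
move=> ea eb eX eY.
by rewrite -{1}(atensa1 a) -{2}(atens1a b) atens_rl // atens_lr.
Qed.

Lemma rdual_transpose (a : arrow C) X : tgt a = rdual X ->
  (ι (rdual X) ⊠ (⌈rev X⌉ • (ι X ⊠ a))) • (⌈rcoev X⌉ ⊠ ι (src a)) = a.
Proof.
move=> ea; rewrite whiskl; first by rewrite /= ea.
rewrite -atensA atens1 -acompA atens_rl ?ea //.
rewrite -{1}(@atens_lr _ 𝟏 (rdual X) _ a) ?acompA //.
by rewrite rzagzig_arr atens1a acomp1a.
Qed.

Lemma rdual_ext (a b : arrow C) X : tgt a = rdual X -> tgt b = rdual X ->
  src a = src b -> ⌈rev X⌉ • (ι X ⊠ a) = ⌈rev X⌉ • (ι X ⊠ b) -> a = b.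
Proof.
by move=> ea eb e H; rewrite -(rdual_transpose ea) H e rdual_transpose.
Qed.

Lemma rev_dinatural X Y (f : hom X Y) :
  ⌈rev X⌉ • (ι X ⊠ ⌈rdualm f⌉) = ⌈rev Y⌉ • (⌈f⌉ ⊠ ι (rdual Y)).
Proof.
rewrite rdualm_arr whiskl; first by ob.
rewrite -(atensA (ι X)) atens1 acompA.
rewrite (@counit_swap _ (Y ⊗ rdual Y) ⌈rev X⌉) //.
rewrite -atens1 -!atensA -acompA -whiskr; first by ob.
rewrite whiskl; first by ob.
rewrite -(atensA (ι X)) atens1 acompA atens_lr //.
rewrite -{1}(acomp1a (a := ⌈rev X⌉) (X := 𝟏)) // -{1}(acompa1 (a := ⌈f⌉) (X := X)) //.
by rewrite atens_comp // atens1a -acompA rzigzag_arr acompa1.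
Qed.

Lemma rdualm_comp X Y V (g : hom Y V) (f : hom X Y) :
  rdualm (g ∘ f) = rdualm f ∘ rdualm g.
Proof.
apply: arr_inj; rewrite arr_comp; apply: (@rdual_ext _ _ X) => //.
rewrite rev_dinatural arr_comp whiskr // whiskl // !acompA rev_dinatural.
rewrite -(acompA (ι X ⊠ _)) atens_lr // -(@atens_rl _ Y (rdual V) ⌈f⌉ ⌈rdualm g⌉) //.
by rewrite acompA rev_dinatural.
Qed.

Lemma rdualm1 X : rdualm (idm X) = idm (rdual X).
Proof.
by apply: arr_inj; apply: (@rdual_ext _ _ X) => //; rewrite rev_dinatural.
Qed.

End Duality.

(** * Fusion operators *)

Section BimonadArrows.
Variables (C : MonoidalCategory) (T : Bimonad C).
Implicit Types (X Y Z : C) (a b : arrow C) (M N : Module T).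

Local Notation τ := (amap T).
Local Notation "'μ' X" := ⌈mmul T X⌉ (at level 8, X at level 8).
Local Notation "'η' X" := ⌈munit T X⌉ (at level 8, X at level 8).
Local Notation T2 := (com2 (bcom T)).
Local Notation T0 := (com0 (bcom T)).

Lemma munit_arr X a : X = src a -> τ a • η X = η (tgt a) • a.
Proof.
case: a => [Y Z [f|]] /= ->; last by rewrite /acomp /=; repeat em.
by rewrite -[τ _]/⌈fmap T f⌉ -!arr_comp (natural (munit T)).
Qed.

Lemma com2_arr X Y a b : X = tgt a -> Y = tgt b ->
  ⌈T2 X Y⌉ • τ (a ⊠ b) = (τ a ⊠ τ b) • ⌈T2 (src a) (src b)⌉.
Proof.
case: a b => [X' X2 [f|]] [Y' Y2 [g|]] /= -> ->;
  try by rewrite /acomp /=; repeat em.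
rewrite -[τ _]/⌈fmap T (f ⊗' g)⌉ -[τ _]/⌈fmap T f⌉.
rewrite -[τ (Arrow (Some g))]/⌈fmap T g⌉.
by rewrite -arr_tens -!arr_comp com2_natural.
Qed.

Lemma arr_com2 X Y a b : X = src a -> Y = src b ->
  (τ a ⊠ τ b) • ⌈T2 X Y⌉ = ⌈T2 (tgt a) (tgt b)⌉ • τ (a ⊠ b).
Proof. by move=> -> ->; rewrite com2_arr. Qed.

Lemma com2A_arr X Y Z : (⌈T2 X Y⌉ ⊠ ι (T Z)) • ⌈T2 (X ⊗ Y) Z⌉
  = (ι (T X) ⊠ ⌈T2 Y Z⌉) • ⌈T2 X (Y ⊗ Z)⌉.
Proof.
have := f_equal (@arr _ _ _) (com2_coassoc (bcom T) X Y Z).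
rewrite !unpack amap_arr arr_eqhom amap1.
by rewrite acompa1 ?acomp1a //=; rewrite ?assoc_ob.
Qed.

Lemma com2_l1 X : (⌈T0⌉ ⊠ ι (T X)) • ⌈T2 𝟏 X⌉ = ι (T X).
Proof.
have := f_equal (@arr _ _ _) (com2_counitl (bcom T) X).
by rewrite !unpack amap_arr arr_eqhom amap1 acomp1a //= lunit_ob.
Qed.

Lemma com2_1r X : (ι (T X) ⊠ ⌈T0⌉) • ⌈T2 X 𝟏⌉ = ι (T X).
Proof.
have := f_equal (@arr _ _ _) (com2_counitr (bcom T) X).
by rewrite !unpack amap_arr arr_eqhom amap1 acomp1a //= runit_ob.
Qed.

Lemma act_arr M : ⌈act M⌉ • τ ⌈act M⌉ = ⌈act M⌉ • μ M.
Proof. by rewrite -amap_arr -!arr_comp (proj1 (actP M)). Qed.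

Lemma act1_arr M : ⌈act M⌉ • η M = ι M.
Proof. by rewrite -arr_comp (proj2 (actP M)). Qed.

Lemma mmul_action X : is_action (mmul T X).
Proof. by split; [apply: mmulA | apply: mmul1]. Qed.

Definition free_mod X : Module T := Build_Module (mmul_action X).

Lemma fmap_linear X Y (f : hom X Y) :
  @is_linear C T (free_mod X) (free_mod Y) (fmap T f).
Proof. by rewrite /is_linear /= (natural (mmul T)). Qed.

(** For [M] free this is the usual fusion operator of the bimonad. *)
Definition fusion M X : hom (T (M ⊗ X)) (M ⊗ T X) := (act M ⊗' idm (T X)) ∘ T2 M X.

Lemma fusion_arr M X : ⌈fusion M X⌉ = (⌈act M⌉ ⊠ ι (T X)) • ⌈T2 M X⌉.
Proof. by rewrite !unpack. Qed.

Lemma tens_act_fusion M N : tens_act M N = (idm M ⊗' act N) ∘ fusion M N.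
Proof. by rewrite /tens_act /fusion compA -tensmM comp1m compm1. Qed.

Lemma fusion_linear M X :
  @is_linear C T (free_mod (M ⊗ X)) (tens_mod M (free_mod X)) (fusion M X).
Proof.
apply: arr_inj; rewrite !arr_comp amap_arr fusion_arr /= /tens_act !unpack /=.
rewrite amap_comp // -acompA -arr_comp -mmul_com2 !unpack !acompA -atens_comp //.
rewrite acomp1a // -act_arr -(acompA (τ (_ ⊠ _))) com2_arr //=.
have -> : (⌈act M⌉ • τ ⌈act M⌉) ⊠ μ X = (⌈act M⌉ ⊠ μ X) • (τ ⌈act M⌉ ⊠ ι (T (T X))).
  by rewrite -atens_comp // acompa1.
by rewrite amap1 !acompA.
Qed.

Lemma fusion_unit M X : ⌈fusion M X⌉ • η (M ⊗ X) = ι M ⊠ η X.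
Proof.
rewrite fusion_arr -acompA -arr_comp -munit_com2 unpack -atens_comp //.
by rewrite act1_arr acomp1a.
Qed.

Lemma fusion_natural M N X Y (l : hom M N) (f : hom X Y) : is_linear l ->
  (⌈l⌉ ⊠ τ ⌈f⌉) • ⌈fusion M X⌉ = ⌈fusion N Y⌉ • τ (⌈l⌉ ⊠ ⌈f⌉).
Proof.
move=> hl; rewrite !fusion_arr -(acompA (τ _)) com2_arr // !acompA -!atens_comp //.
by rewrite acompa1 // acomp1a // -arr_comp hl arr_comp.
Qed.

Lemma fmap_fusion M X Y (f : hom X Y) :
  (idm M ⊗' fmap T f) ∘ fusion M X = fusion M Y ∘ fmap T (idm M ⊗' f).
Proof.
apply: arr_inj; rewrite [LHS]arr_comp [RHS]arr_comp.
exact: (fusion_natural f (linear_id M)).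
Qed.

Lemma fusion_tens M N X :
  ⌈fusion (tens_mod M N) X⌉ = (ι M ⊠ ⌈fusion N X⌉) • ⌈fusion M (N ⊗ X)⌉.
Proof.
rewrite !fusion_arr /= /tens_act !unpack whiskr //= -acompA com2A_arr.
rewrite !acompA atens_rl // atensA -atens_comp //.
by rewrite acompa1.
Qed.

End BimonadArrows.

(** * Dual modules and the inverse of the fusion operator *)

Section Fusion.
Variables (C : AutonomousCategory) (T : HopfMonad C).
Implicit Types (X Y V W : C) (M N U : Module T).

Local Notation τ := (amap T).
Local Notation "'μ' X" := ⌈mmul T X⌉ (at level 8, X at level 8).
Local Notation "'η' X" := ⌈munit T X⌉ (at level 8, X at level 8).
Local Notation T2 := (com2 (bcom T)).
Local Notation T0 := (com0 (bcom T)).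

(** The structure map on the dual for which [rev N] and [rcoev N] are T-linear; see [rev_linear] and
    [rcoev_linear]. *)
Definition rdual_act N : hom (T (rdual N)) (rdual N) :=
  sr T N ∘ fmap T (rdualm (act N)).

Lemma rant_ev_arr X :
  ⌈rev (T X)⌉ • (ι (T X) ⊠ (⌈sr T (T X)⌉ • τ ⌈rdualm (mmul T X)⌉))
    • ⌈T2 X (rdual (T X))⌉
  = ⌈T0⌉ • τ ⌈rev X⌉ • τ (ι X ⊠ ⌈rdualm (munit T X)⌉).
Proof.
have := f_equal (@arr _ _ _) (rant_ev (sr T) X).
by move=> e; rewrite !arr_comp !arr_tens !arr_comp in e; symmetry; exact: e.
Qed.

Lemma rant_coev_arr X :
  (⌈sr T X⌉ ⊠ μ X) • ⌈T2 (rdual (T X)) (T X)⌉ • τ ⌈rcoev (T X)⌉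
  = (ι (rdual X) ⊠ η X) • ⌈rcoev X⌉ • ⌈T0⌉.
Proof.
have := f_equal (@arr _ _ _) (rant_coev (sr T) X).
by move=> e; rewrite !arr_comp !arr_tens in e; symmetry; exact: e.
Qed.

(** Naturality of the antipode at [act N] and the action axiom bring in the dual of μ, which is the
    form required by the evaluation axiom of the antipode. *)
Lemma rdualm_rdual_act N : rdualm (act N) ∘ rdual_act N
  = sr T (T N) ∘ fmap T (rdualm (mmul T N)) ∘ fmap T (rdualm (act N)).
Proof.
rewrite /rdual_act compA rant_natural -!compA -!fmapM -!rdualm_comp.
by rewrite (proj1 (actP N)).
Qed.

Lemma rev_linear N :
  ⌈rev N⌉ • (⌈act N⌉ ⊠ ⌈rdual_act N⌉) • ⌈T2 N (rdual N)⌉ = ⌈T0⌉ • τ ⌈rev N⌉.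
Proof.
rewrite -(@atens_lr _ (T N) (rdual N) ⌈act N⌉) // acompA -rev_dinatural.
rewrite -(acompA _ (ι _ ⊠ ⌈rdualm _⌉)) -whiskl // -arr_comp rdualm_rdual_act.
rewrite arr_comp whiskl // acompA -(acompA ⌈T2 _ _⌉) amap_arr.
rewrite -(amap1 T N) arr_com2 //= acompA.
rewrite amap1 arr_comp amap_arr rant_ev_arr.
rewrite -(acompA (τ _)) -amap_comp //.
rewrite -whiskl // -arr_comp -rdualm_comp (proj2 (actP N)) rdualm1.
by rewrite atens1 amap1 acompa1.
Qed.

Lemma rcoev_linear N :
  (⌈rdual_act N⌉ ⊠ ⌈act N⌉) • ⌈T2 (rdual N) N⌉ • τ ⌈rcoev N⌉ = ⌈rcoev N⌉ • ⌈T0⌉.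
Proof.
rewrite -{1}(acompa1 (a := ⌈act N⌉) (X := T N)) // arr_comp atens_comp //.
rewrite amap_arr -(amap1 T N) -(acompA ⌈T2 _ _⌉) arr_com2 //=.
rewrite acompA -acompA -amap_comp // rcoev_dinatural amap_comp //.
rewrite acompA -(acompA (τ (_ ⊠ _))) com2_arr //= acompA -atens_comp // amap1 acompa1 //.
rewrite act_arr -{1}(acomp1a (a := ⌈sr T N⌉) (X := rdual N)) // atens_comp //.
rewrite -!acompA (acompA _ _ (_ ⊠ μ _)) rant_coev_arr !acompA -whiskl //.
by rewrite act1_arr atens1 acomp1a.
Qed.

(** T applied to the coevaluation of [N], followed by the fusion map built from [rdual_act N]. *)
Definition rcoev_act N X : hom (T X) (rdual N ⊗ T (N ⊗ X)) :=
  (rdual_act N ⊗' idm (T (N ⊗ X))) ∘ T2 (rdual N) (N ⊗ X)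
    ∘ fmap T (assoc (rdual N) N X ∘ (rcoev N ⊗' idm X) ∘ lunitV X).

(** The mate of [rcoev_act N X] under the duality of [N]. *)
Definition fusion_inv N X : hom (N ⊗ T X) (T (N ⊗ X)) :=
  lunit (T (N ⊗ X)) ∘ (rev N ⊗' idm (T (N ⊗ X)))
    ∘ assocV N (rdual N) (T (N ⊗ X)) ∘ (idm N ⊗' rcoev_act N X).

Lemma rcoev_act_arr N X : ⌈rcoev_act N X⌉ =
  (⌈rdual_act N⌉ ⊠ ι (T (N ⊗ X))) • ⌈T2 (rdual N) (N ⊗ X)⌉ • τ (⌈rcoev N⌉ ⊠ ι X).
Proof.
rewrite !arr_comp amap_arr !unpack; congr (_ • amap _ _).
by rewrite acompa1 ?acomp1a //; ob.
Qed.

Lemma fusion_inv_arr N X : ⌈fusion_inv N X⌉ =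
  (⌈rev N⌉ ⊠ ι (T (N ⊗ X))) • (ι N ⊠ ⌈rcoev_act N X⌉).
Proof.
rewrite /fusion_inv 3!arr_comp !arr_tens /lunit /assocV !arr_eqhom acomp1a; try ob.
by rewrite acompa1; try ob.
Qed.

(** Coassociativity brings the structure maps of the dual and of [N] together; [rcoev_linear] turns
    them into [T0], which the counit law removes. *)
Lemma fusion_rcoev_act N X :
  (ι (rdual N) ⊠ ⌈fusion N X⌉) • ⌈rcoev_act N X⌉ = ⌈rcoev N⌉ ⊠ ι (T X).
Proof.
rewrite fusion_arr rcoev_act_arr !acompA -atens_comp //= acomp1a //.
rewrite acompa1 // -{1}(acompa1 (a := ⌈rdual_act N⌉) (X := T (rdual N))) // atens_comp //.
rewrite -(acompA _ (ι _ ⊠ _)) -com2A_arr -!acompA com2_arr //= amap1.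
rewrite (acompA _ _ (⌈T2 _ _⌉ ⊠ _)) -whiskr // -atensA (acompA _ _ (_ ⊠ ι _)).
rewrite -whiskr // acompA rcoev_linear whiskr // -acompA com2_l1 acompa1 //=.
by rewrite lunit_ob.
Qed.

Lemma fusionK N X : fusion N X ∘ fusion_inv N X = idm _.
Proof.
apply: arr_inj; rewrite arr_comp fusion_inv_arr acompA.
rewrite -{1}(atens1a ⌈fusion N X⌉) atens_rl //.
rewrite -(@atens_lr _ (N ⊗ rdual N) (N ⊗ T X) ⌈rev N⌉) //.
rewrite -acompA -(atens1 N (rdual N)) atensA -whiskl // fusion_rcoev_act.
rewrite -atens1 -!atensA -whiskr; first by ob.
by rewrite rzigzag_arr atens1.
Qed.

(** Here coassociativity makes [rev_linear] applicable; after the counit law, a zigzag under T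
    remains. *)
Lemma fusion_invK N X : fusion_inv N X ∘ fusion N X = idm _.
Proof.
apply: arr_inj; rewrite arr_comp fusion_inv_arr fusion_arr -!acompA.
rewrite (acompA _ _ (ι N ⊠ _)) atens_rl // rcoev_act_arr.
rewrite -{1}(acompa1 (a := ⌈act N⌉) (X := T N)) // -!acompA atens_comp // -!acompA.
rewrite whiskl; first by ob.
rewrite -acompA -(amap1 T N) arr_com2 //=; first by ob.
rewrite amap1 assoc_ob (acompA _ ⌈T2 _ _⌉) -com2A_arr -!acompA.
rewrite -atensA (acompA _ _ (_ ⊠ ι _)) -whiskr // acompA -whiskr // acompA rev_linear.
rewrite whiskr // -(acompA ⌈T2 _ _⌉) -(amap1 T (N ⊗ X)) arr_com2 //= amap1 acompA.
rewrite com2_l1 acomp1a; first by ob.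
rewrite -amap_comp; first by ob.
rewrite -atens1 -!atensA -whiskr; first by ob.
by rewrite rzigzag_arr atens1 amap1.
Qed.

(** * The mirror fusion operator and left duals *)

Definition ldual_act N : hom (T (ldual N)) (ldual N) :=
  sl T N ∘ fmap T (ldualm (act N)).

Lemma lant_coev_arr X :
  (μ X ⊠ ⌈sl T X⌉) • ⌈T2 (T X) (ldual (T X))⌉ • τ ⌈lcoev (T X)⌉
  = (η X ⊠ ι (ldual X)) • ⌈lcoev X⌉ • ⌈T0⌉.
Proof.
have := f_equal (@arr _ _ _) (lant_coev (sl T) X).
by move=> e; rewrite !arr_comp !arr_tens in e; symmetry; exact: e.
Qed.

Lemma lcoev_linear N :
  (⌈act N⌉ ⊠ ⌈ldual_act N⌉) • ⌈T2 N (ldual N)⌉ • τ ⌈lcoev N⌉ = ⌈lcoev N⌉ • ⌈T0⌉.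
Proof.
rewrite -{1}(acompa1 (a := ⌈act N⌉) (X := T N)) // arr_comp atens_comp //.
rewrite amap_arr -(amap1 T N) -(acompA ⌈T2 _ _⌉) arr_com2 //=.
rewrite acompA -acompA -amap_comp // lcoev_dinatural amap_comp //.
rewrite acompA -(acompA (τ (_ ⊠ _))) com2_arr //= acompA -atens_comp // amap1 acompa1 //.
rewrite act_arr -{1}(acomp1a (a := ⌈sl T N⌉) (X := ldual N)) // atens_comp //.
rewrite -!acompA (acompA _ _ (μ _ ⊠ _)) lant_coev_arr !acompA -whiskr //.
by rewrite act1_arr atens1 acomp1a.
Qed.

Definition fusionr X N : hom (T (X ⊗ N)) (T X ⊗ N) := (idm (T X) ⊗' act N) ∘ T2 X N.

Definition lcoev_act X N : hom (T X) (T (X ⊗ N) ⊗ ldual N) :=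
  (idm (T (X ⊗ N)) ⊗' ldual_act N) ∘ T2 (X ⊗ N) (ldual N)
    ∘ fmap T (assocV X N (ldual N) ∘ (idm X ⊗' lcoev N) ∘ runitV X).

Definition fusionr_inv X N : hom (T X ⊗ N) (T (X ⊗ N)) :=
  runit (T (X ⊗ N)) ∘ (idm (T (X ⊗ N)) ⊗' lev N)
    ∘ assoc (T (X ⊗ N)) (ldual N) N ∘ (lcoev_act X N ⊗' idm N).

Lemma fusionr_arr X N : ⌈fusionr X N⌉ = (ι (T X) ⊠ ⌈act N⌉) • ⌈T2 X N⌉.
Proof. by rewrite !unpack. Qed.

Lemma lcoev_act_arr X N : ⌈lcoev_act X N⌉ =
  (ι (T (X ⊗ N)) ⊠ ⌈ldual_act N⌉) • ⌈T2 (X ⊗ N) (ldual N)⌉ • τ (ι X ⊠ ⌈lcoev N⌉).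
Proof.
rewrite !arr_comp amap_arr !unpack; congr (_ • amap _ _).
by rewrite acompa1 ?acomp1a //; ob.
Qed.

Lemma fusionr_inv_arr X N : ⌈fusionr_inv X N⌉ =
  (ι (T (X ⊗ N)) ⊠ ⌈lev N⌉) • (⌈lcoev_act X N⌉ ⊠ ι N).
Proof.
rewrite /fusionr_inv 3!arr_comp !arr_tens /runit /assoc !arr_eqhom acomp1a; try ob.
by rewrite acompa1; try ob.
Qed.

Lemma fusionr_lcoev_act X N :
  (⌈fusionr X N⌉ ⊠ ι (ldual N)) • ⌈lcoev_act X N⌉ = ι (T X) ⊠ ⌈lcoev N⌉.
Proof.
rewrite fusionr_arr lcoev_act_arr !acompA -atens_comp //= acomp1a //.
rewrite acompa1 // -{1}(acompa1 (a := ⌈ldual_act N⌉) (X := T (ldual N))) // atens_comp //.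
rewrite -(acompA _ (_ ⊠ ι _)) com2A_arr -!acompA com2_arr //= ?amap1; try ob.
rewrite (acompA _ _ (_ ⊠ ⌈T2 _ _⌉)) -whiskl // atensA (acompA _ _ (ι _ ⊠ _)).
rewrite -whiskl // acompA lcoev_linear whiskl // -acompA com2_1r acompa1 //=.
by rewrite runit_ob.
Qed.

Lemma fusionrK X N : fusionr X N ∘ fusionr_inv X N = idm _.
Proof.
apply: arr_inj; rewrite arr_comp fusionr_inv_arr acompA.
rewrite -{1}(atensa1 ⌈fusionr X N⌉) atens_lr //.
rewrite -(@atens_rl _ (T X ⊗ N) (ldual N ⊗ N) _ ⌈lev N⌉) //.
rewrite -acompA -(atens1 (ldual N)) -atensA -whiskr // fusionr_lcoev_act.
rewrite -atens1 !atensA -whiskl; first by ob.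
by rewrite lzigzag_arr atens1.
Qed.

(** * Linear transposes *)

Lemma fusion_inv_linear M V :
  @is_linear C T (tens_mod M (free_mod T V)) (free_mod T (M ⊗ V)) (fusion_inv M V).
Proof.
rewrite /is_linear -[LHS]compm1 -(fmap1 T (M ⊗ T V)) -(fusionK M V) fmapM.
have := fusion_linear M V; rewrite /is_linear => H.
by rewrite compA -(compA _ _ (fmap T (fusion M V))) -H compA fusion_invK comp1m.
Qed.

Lemma fusion_inv_unit M V : fusion_inv M V ∘ (idm M ⊗' munit T V) = munit T (M ⊗ V).
Proof.
rewrite -[RHS]comp1m -(fusion_invK M V) -compA; congr (_ ∘ _).
by apply: arr_inj; rewrite arr_comp fusion_unit.
Qed.

Lemma fusion_inv_natural M N V (l : hom M N) : is_linear l ->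
  fmap T (l ⊗' idm V) ∘ fusion_inv M V = fusion_inv N V ∘ (l ⊗' idm (T V)).
Proof.
move=> hl.
have e : fusion N V ∘ fmap T (l ⊗' idm V) = (l ⊗' idm (T V)) ∘ fusion M V.
  have := fusion_natural (idm V) hl; rewrite amap1 => e.
  by apply: arr_inj; rewrite [LHS]arr_comp [RHS]arr_comp; symmetry; exact: e.
rewrite -[LHS]comp1m -(fusion_invK N V) -[LHS]compA.
rewrite (compA (fusion N V) (fmap T _) (fusion_inv M V)) e.
by rewrite -(compA _ (fusion M V) (fusion_inv M V)) fusionK compm1.
Qed.

Lemma fusion_inv_tens M N V :
  ⌈fusion M (N ⊗ V)⌉ • ⌈fusion_inv (tens_mod M N) V⌉ = ι M ⊠ ⌈fusion_inv N V⌉.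
Proof.
have e : ⌈fusion M (N ⊗ V)⌉
    = (ι M ⊠ ⌈fusion_inv N V⌉) • ⌈fusion (tens_mod M N) V⌉.
  by rewrite fusion_tens acompA -whiskl // -arr_comp fusion_invK atens1 acomp1a.
by rewrite e -acompA -arr_comp fusionK acompa1; try ob.
Qed.

(** Since [fusion_inv] identifies [M ⊗ T V] with the free module on [M ⊗ V], this is the T-linear
    extension of [P]. *)
Definition transpose M U V (P : hom (M ⊗ V) U) : hom (M ⊗ T V) U :=
  act U ∘ fmap T P ∘ fusion_inv M V.

Lemma transpose_linear M U V (P : hom (M ⊗ V) U) :
  @is_linear C T (tens_mod M (free_mod T V)) U (transpose P).
Proof.
have H := fusion_inv_linear M V; rewrite /is_linear in H.
rewrite /is_linear /transpose -[LHS]compA H.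
rewrite (fmapM T (act U ∘ fmap T P)) (fmapM T (act U)).
rewrite [RHS]compA (compA (act U)) (proj1 (actP U)) -(compA (act U) (mmul T U)).
have e : fmap T P ∘ mmul T (M ⊗ V) = mmul T U ∘ fmap T (fmap T P).
  exact: (natural (mmul T) P).
by rewrite -e (compA (act U)) [LHS]compA.
Qed.

Lemma transpose_unit M U V (P : hom (M ⊗ V) U) :
  transpose P ∘ (idm M ⊗' munit T V) = P.
Proof.
rewrite /transpose -(compA _ (fusion_inv M V)) fusion_inv_unit -compA.
by rewrite (natural (munit T) P) compA (proj2 (actP U)) comp1m.
Qed.

(** Linearity of the transpose turns the action of [U] on its restriction into the transpose
    composed with [fusionr]. The right inverse of [fusionr] returns the whole transpose, and
    restricting along the unit of [V] gives [P]. *)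
Lemma free_transposeK X V U (P : hom (T X ⊗ V) U) :
  act U ∘ fmap T (@transpose (free_mod T X) U V P ∘ (munit T X ⊗' idm (T V)))
    ∘ fusionr_inv X (free_mod T V) ∘ (idm (T X) ⊗' munit T V) = P.
Proof.
rewrite fmapM compA -(transpose_linear (M := free_mod T X) P) -(compA _ _ (fmap T _)).
have -> : act (tens_mod (free_mod T X) (free_mod T V))
   ∘ fmap T (munit T X ⊗' idm (T V)) = fusionr X (free_mod T V).
  by rewrite /= /tens_act -compA -com2_natural compA -tensmM m1mul fmap1 compm1.
rewrite -(compA _ _ (fusionr_inv _ _)) fusionrK compm1.
by rewrite (transpose_unit (M := free_mod T X)).
Qed.

Lemma free_transpose_inj X V U (P P' : hom (T X ⊗ V) U) :
  @transpose (free_mod T X) U V P ∘ (munit T X ⊗' idm (T V))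
  = @transpose (free_mod T X) U V P' ∘ (munit T X ⊗' idm (T V)) -> P = P'.
Proof. by move=> e; rewrite -(free_transposeK P) e free_transposeK. Qed.

Lemma transpose_linear_comp M N U V (l : hom M N) (P : hom (N ⊗ V) U) :
  is_linear l -> transpose (P ∘ (l ⊗' idm V)) = transpose P ∘ (l ⊗' idm (T V)).
Proof.
move=> hl; rewrite /transpose fmapM compA -(compA _ _ (fusion_inv M V)).
by rewrite fusion_inv_natural // -[RHS]compA.
Qed.

(** The action on [N ⊗ U] contributes [fusion N (M ⊗ V)], which reduces the inverse fusion of
    [N ⊗ M] to that of [M]. *)
Lemma transpose_tens M N U V (P : hom (M ⊗ V) U) :
  ⌈@transpose (tens_mod N M) (tens_mod N U) V ((idm N ⊗' P) ∘ assoc N M V)⌉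
  = ι N ⊠ ⌈transpose P⌉.
Proof.
rewrite /transpose [LHS]arr_comp [in LHS]arr_comp amap_arr.
rewrite [⌈_ ∘ assoc _ _ _⌉]arr_comp /assoc arr_eqhom acompa1; first by ob.
rewrite arr_tens /= /tens_act arr_comp arr_tens -(acompA (τ _)) com2_arr //= amap1 acompA.
rewrite -atens_comp // acompa1 // -{1}(acomp1a (a := ⌈act N⌉) (X := N)) //.
rewrite -{1}(acompa1 (a := _ • τ ⌈P⌉) (X := T (M ⊗ V))) // atens_comp //.
rewrite -(acompA _ (⌈act N⌉ ⊠ _)) -fusion_arr -acompA fusion_inv_tens -whiskl //.
by rewrite [in RHS]arr_comp [in RHS]arr_comp amap_arr.
Qed.

(** * Detecting morphisms out of [T X] *)

(* Letting [V] vary is what makes this property pass from [X] to [T X]: transposition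
   replaces [V] by [T V]. *)
Definition separating X (D : Module T -> C)
    (δ : forall N, hom (D N) (N ⊗ X)) : Prop :=
  forall V U (P P' : hom (X ⊗ V) U),
    (forall N, (idm N ⊗' P) ∘ assoc N X V ∘ (δ N ⊗' idm V)
       = (idm N ⊗' P') ∘ assoc N X V ∘ (δ N ⊗' idm V)) ->
    P = P'.

Lemma separating_fusion X D (δ : forall N, hom (D N) (N ⊗ X)) :
  separating δ -> separating (fun N => fusion N X ∘ fmap T (δ N)).
Proof.
(* It suffices to compare the transposes restricted to [X ⊗ T V], where [sep] applies with [T V] in
   place of [V]. *)
move=> sep V U P P' e; apply: free_transpose_inj; apply: sep => N.
pose l := fusion N X ∘ fmap T (δ N).
have hl : @is_linear C T (free_mod T (D N)) (tens_mod N (free_mod T X)) l.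
  have H := fusion_linear N X; have H' := fmap_linear T (δ N).
  rewrite /is_linear in H H'.
  by rewrite /is_linear /l -compA H' compA H -compA -fmapM.
have hη : ⌈l⌉ • η (D N) = (ι N ⊠ η X) • ⌈δ N⌉.
  by rewrite arr_comp amap_arr -acompA munit_arr // acompA fusion_unit.
(* Testing the restricted transpose of [Q] against [δ N] gives a restriction of the transpose of the
   composite that the hypothesis [e] controls. *)
have key (Q : hom (T X ⊗ V) U) :
    (idm N ⊗' (@transpose (free_mod T X) U V Q ∘ (munit T X ⊗' idm (T V))))
      ∘ assoc N X (T V) ∘ (δ N ⊗' idm (T V))
    = @transpose (free_mod T (D N)) (tens_mod N U) V
        ((idm N ⊗' Q) ∘ assoc N (T X) V ∘ (l ⊗' idm V))
      ∘ (munit T (D N) ⊗' idm (T V)).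
  have := @transpose_linear_comp (free_mod T (D N)) (tens_mod N (free_mod T X))
    (tens_mod N U) V l ((idm N ⊗' Q) ∘ assoc N (T X) V) hl => /= ->.
  apply: arr_inj; rewrite [RHS]arr_comp [in RHS]arr_comp.
  rewrite (@transpose_tens (free_mod T X) N U V Q).
  rewrite -[RHS]acompA !arr_tens -whiskr // hη.
  rewrite [LHS]arr_comp [⌈_ ∘ assoc _ _ _⌉]arr_comp /assoc arr_eqhom acompa1 //.
  rewrite !arr_tens arr_comp arr_tens whiskl // whiskr //.
  by rewrite atensA acompA.
by rewrite !key e.
Qed.

(** As [separating] concerns maps into modules, take [V = 𝟏] and compose with the unit of [W] into
    the free module; [e] cancels this unit. Asking only for a retraction makes the lemma available
    for [Z M] before its structure map is known to be an action. *)
Lemma separating_map X D (δ : forall N, hom (D N) (N ⊗ X)) W (e : hom (T W) W)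
    (f f' : hom X W) :
  separating δ -> e ∘ munit T W = idm W ->
  (forall N, (idm N ⊗' f) ∘ δ N = (idm N ⊗' f') ∘ δ N) -> f = f'.
Proof.
move=> sep eη H.
have {sep}/(_ 𝟏 (free_mod T W) (munit T W ∘ f ∘ runit X)
    (munit T W ∘ f' ∘ runit X)) sep := sep.
have key (g : hom X W) N :
    ⌈(idm N ⊗' (munit T W ∘ g ∘ runit X)) ∘ assoc N X 𝟏 ∘ (δ N ⊗' idm 𝟏)⌉
    = (ι N ⊠ η W) • ⌈(idm N ⊗' g) ∘ δ N⌉.
  rewrite !arr_comp /assoc arr_eqhom acompa1 ?arr_tens; first by ob.
  rewrite !arr_comp /runit arr_eqhom (acompa1 (X := X)) // whiskl // atensa1.
  by rewrite acompA.
have {sep H key} : munit T W ∘ f ∘ runit X = munit T W ∘ f' ∘ runit X.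
  by apply: sep => N; apply: arr_inj; rewrite !key H.
move/(f_equal (@arr _ _ _)); rewrite !arr_comp /runit arr_eqhom !acompa1 // => H.
apply: arr_inj; rewrite -[LHS](acomp1a (X := W)) // -[RHS](acomp1a (X := W)) //.
by rewrite -eη arr_comp -!acompA H.
Qed.

End Fusion.

(** * The lifted centralizer *)

Section Centralizer.
Variables (C : AutonomousCategory) (T : HopfMonad C) (Z : Functor C C).
Variable d : forall X Y : C, hom (X ⊗ Y) (T Y ⊗ Z X).
Implicit Types (X Y W V : C) (M N U : Module T).

Local Notation τ := (amap T).
Local Notation "'μ' X" := ⌈mmul T X⌉ (at level 8, X at level 8).
Local Notation T2 := (com2 (bcom T)).

Lemma univ_dinat_arr X Y : ⌈univ_dinat d X Y⌉ =
  (⌈lev (T Y)⌉ ⊠ ι (Z X)) • (ι (ldual (T Y)) ⊠ ⌈d X Y⌉).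
Proof.
rewrite /univ_dinat 3!arr_comp !arr_tens /lunit /assocV !arr_eqhom.
rewrite acomp1a; try ob.
by rewrite acompa1; try ob.
Qed.

Lemma univ_dinat_mate X Y : ⌈d X Y⌉ =
  (ι (T Y) ⊠ ⌈univ_dinat d X Y⌉) • (⌈lcoev (T Y)⌉ ⊠ ι (X ⊗ Y)).
Proof.
rewrite univ_dinat_arr whiskl; first by ob.
rewrite -(atensA _ _ ⌈d X Y⌉) atens1 -acompA atens_rl //.
rewrite -(@atens_lr _ 𝟏 (T Y ⊗ Z X) _ ⌈d X Y⌉) // acompA -atens1 -!atensA.
rewrite -whiskr; first by ob.
by rewrite lzigzag_arr atens1 atens1a acomp1a.
Qed.

Hypothesis cd : is_centralizer d.

(** Uniqueness in the universal property, for the natural family through which both [f] and [g]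
    factor. *)
Lemma centralizer_ext X W (f g : hom (Z X) W) :
  (forall Y, (idm (T Y) ⊗' f) ∘ d X Y = (idm (T Y) ⊗' g) ∘ d X Y) -> f = g.
Proof.
move=> e.
have nat Y Y' (h : hom Y Y') : (fmap T h ⊗' idm W) ∘ ((idm (T Y) ⊗' f) ∘ d X Y)
    = (idm (T Y') ⊗' f) ∘ d X Y' ∘ (idm X ⊗' h).
  rewrite -compA -(centralizer_natural cd (idm X)) fmap1 !compA -!tensmM.
  by rewrite !comp1m !compm1.
have [r [_ uniq]] := centralizer_universal cd nat.
by rewrite -(uniq f) // -(uniq g).
Qed.

Lemma lift_d_free M Y : lift_d d M (free_mod T Y) ∘ (idm M ⊗' munit T Y) = d M Y.
Proof.
rewrite /lift_d -compA -(centralizer_natural cd (idm M)) compA -tensmM fmap1.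
by rewrite /= m1mul comp1m tensm1 comp1m.
Qed.

(** Free modules suffice, since [lift_d_free] recovers ∂ from the components at them. *)
Lemma lift_d_ext M W (f g : hom (Z M) W) :
  (forall N, (idm N ⊗' f) ∘ lift_d d M N = (idm N ⊗' g) ∘ lift_d d M N) -> f = g.
Proof.
move=> e; apply: centralizer_ext => Y.
have /= H := e (free_mod T Y); rewrite -lift_d_free.
by rewrite (compA _ (lift_d d M (free_mod T Y))) H -(compA _ (lift_d d M (free_mod T Y))).
Qed.

(** The family [lift_d] tests only morphisms out of [Z M], so [V] is moved to the target by its left
    dual: [p Q] is the resulting transpose of [Q], and [pK] recovers [Q]. *)
Lemma separating_lift_d M : separating (lift_d d M).
Proof.
move=> V U P P' e.
pose p (Q : hom (Z M ⊗ V) U) :=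
  (Q ⊗' idm (ldual V)) ∘ assocV (Z M) V (ldual V) ∘ (idm (Z M) ⊗' lcoev V)
    ∘ runitV (Z M).
have pE Q : ⌈p Q⌉ = (⌈Q⌉ ⊠ ι (ldual V)) • (ι (Z M) ⊠ ⌈lcoev V⌉).
  rewrite /p 3!arr_comp !arr_tens /assocV /runitV !arr_eqhom.
  by rewrite acompa1 ?acompa1 //; ob.
have pK Q : (ι U ⊠ ⌈lev V⌉) • (⌈p Q⌉ ⊠ ι V) = ⌈Q⌉.
  rewrite pE whiskr; first by ob. rewrite acompA 2!atensA atens1 atens_rl //.
  rewrite -(@atens_lr _ (Z M ⊗ V) 𝟏 ⌈Q⌉ ⌈lev V⌉) // atensa1 -acompA -atens1 atensA.
  by rewrite -whiskl ?lzigzag_arr ?atens1 ?acompa1 //; ob.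
have key Q N : (ι N ⊠ ⌈p Q⌉) • ⌈lift_d d M N⌉
    = (⌈(idm N ⊗' Q) ∘ assoc N (Z M) V ∘ (lift_d d M N ⊗' idm V)⌉ ⊠ ι (ldual V))
      • (ι (M ⊗ N) ⊠ ⌈lcoev V⌉).
  rewrite 2!arr_comp !arr_tens /assoc arr_eqhom acompa1; first by ob.
  rewrite pE whiskl; first by ob. rewrite whiskr; first by ob.
  rewrite -!acompA !atensA; congr (_ • _).
  by rewrite -atensA !atens1 -{1}(atensa1 ⌈lift_d d M N⌉) atens_rl ?atens_lr.
have {e} : p P = p P'.
  apply: lift_d_ext => N; apply: arr_inj.
  by rewrite [LHS]arr_comp [RHS]arr_comp !arr_tens !key e.
by move=> e'; apply: arr_inj; rewrite -pK e' pK.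
Qed.

(** * The canonical law and the lifted action *)

Variable Om : NatTrans (fcomp T Z) (fcomp Z T).
Hypothesis law : is_canonical_law d Om.
Local Notation ρ := (lift_act Om).

Lemma canonical_law_mate X Y :
  (mmul T Y ⊗' Om X) ∘ T2 (T Y) (Z X) ∘ fmap T (d X Y)
  = (mmul T Y ⊗' idm (Z (T X))) ∘ d (T X) (T Y) ∘ T2 X Y.
Proof.
(* The antipode and one dual of μ are grouped into the structure map on the left dual of the free
   module on [Y], so that [lcoev_linear] can absorb them. *)
have e : ⌈Om X⌉ • τ ⌈univ_dinat d X Y⌉
    = ⌈univ_dinat d (T X) (T Y)⌉
      • ((⌈ldualm (mmul T Y)⌉ • ⌈ldual_act (free_mod T Y)⌉) ⊠ ⌈T2 X Y⌉)
      • ⌈T2 (ldual (T Y)) (X ⊗ Y)⌉.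
  have := f_equal (@arr _ _ _) (law X Y); rewrite [X in X = _]arr_comp => ->.
  rewrite [LHS]arr_comp [in LHS]arr_comp arr_tens /com3 [⌈_ ∘ T2 _ _⌉]arr_comp arr_tens.
  rewrite acompA -[in LHS](acompA (ι _ ⊠ _)) atens_lr //.
  by rewrite /ldual_act -[in RHS]arr_comp compA.
have e1 := univ_dinat_mate X Y; have e2 := univ_dinat_mate (T X) (T Y).
move: (univ_dinat d X Y) (univ_dinat d (T X) (T Y)) e e1 e2 => i i' e e1 e2.
apply: arr_inj; rewrite !arr_comp !arr_tens amap_arr e2 e1 amap_comp //; first by ob.
rewrite acompA -(acompA (τ (_ ⊠ ⌈i⌉))) com2_arr //= amap1 acompA -atens_comp //.
rewrite acompa1 // e.
have H (l a b : arrow C) : tgt a = ldual (T Y) -> tgt l = ldual (T (T Y)) ->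
    src l = ldual (T Y) -> src (a ⊠ ⌈T2 X Y⌉) = tgt b ->
    μ Y ⊠ (⌈i'⌉ • ((l • a) ⊠ ⌈T2 X Y⌉) • b)
    = (ι (T Y) ⊠ ⌈i'⌉) • (ι (T Y) ⊠ l ⊠ ι (T X ⊗ T Y))
      • (μ Y ⊠ a ⊠ ⌈T2 X Y⌉) • (ι (T (T Y)) ⊠ b).
  move=> h1 h2 h3 h4.
  have hla : (l • a) ⊠ ⌈T2 X Y⌉ = (l ⊠ ι (T X ⊗ T Y)) • (a ⊠ ⌈T2 X Y⌉).
    by rewrite -atens_comp ?h1 ?h3 // acomp1a.
  rewrite -!atens_comp /= ?h1 ?h2 ?h3 //.
  by rewrite !(acomp1a (X := T Y)) // acompa1 // hla acompA.
rewrite H // -!acompA (acompA _ _ (ι _ ⊠ ⌈T2 _ _⌉)) -com2A_arr -acompA com2_arr //= amap1.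
rewrite (acompA _ (τ _ ⊠ _)) -whiskr // -(atensA (μ Y) _ ⌈T2 X Y⌉).
rewrite (acompA _ ((_ • _) ⊠ _)) -atens_comp // acompa1 //.
(* This eliminates the antipode. *)
have lc := lcoev_linear (free_mod T Y); rewrite /= -acompA in lc; rewrite lc.
rewrite -{1}(acompa1 (a := ⌈T2 X Y⌉) (X := T (X ⊗ Y))) // atens_comp // -!acompA com2_l1.
rewrite acompa1 /= ?lunit_ob // -atensA -atens_comp // acomp1a // lcoev_dinatural.
rewrite [in RHS]acompA atens_lr //.
rewrite -(@atens_rl _ (T Y) (ldual (T (T Y)) ⊗ T X ⊗ T Y) (μ Y) ⌈i'⌉) //.
rewrite -!acompA; congr (_ • _).
rewrite -atens1 -atensA acompA -whiskr; first by ob.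
by rewrite -(@atens_lr _ 𝟏 (T X ⊗ T Y) _ ⌈T2 X Y⌉) // atens1a.
Qed.

(** This is the linearity of ∂~, phrased with [fusion] so as to make sense before [ρ M] is known to
    be an action. It is [canonical_law_mate] followed by [act N ⊗ Z (act M)]. *)
Lemma lift_d_act M N : lift_d d M N ∘ tens_act M N
  = (idm N ⊗' ρ M) ∘ (fusion N (Z M) ∘ fmap T (lift_d d M N)).
Proof.
have H := canonical_law_mate M N.
have -> : (idm N ⊗' ρ M) ∘ (fusion N (Z M) ∘ fmap T (lift_d d M N))
    = (act N ⊗' fmap Z (act M)) ∘ ((mmul T N ⊗' Om M) ∘ T2 (T N) (Z M) ∘ fmap T (d M N)).
  rewrite /lift_d fmapM /fusion !compA -tensmM compm1 comp1m.
  rewrite -(compA _ (T2 _ _) (fmap T _)) -com2_natural fmap1 !compA -!tensmM.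
  by rewrite compm1 (proj1 (actP N)).
rewrite H /lift_d /tens_act !compA -[X in _ = X ∘ _ ∘ _]tensmM compm1 -(proj1 (actP N)).
by rewrite -(compA _ (d M N)) -(centralizer_natural cd) compA -tensmM comp1m.
Qed.

Lemma lift_act_unit M : ρ M ∘ munit T (Z M) = idm (Z M).
Proof.
apply: lift_d_ext => N; rewrite tensm1 comp1m; apply: arr_inj.
have H : ⌈lift_d d M N⌉ • ⌈tens_act M N⌉
    = (ι N ⊠ ⌈ρ M⌉) • ⌈fusion N (Z M) ∘ fmap T (lift_d d M N)⌉.
  by rewrite -arr_comp lift_d_act [LHS]arr_comp arr_tens.
rewrite [LHS]arr_comp !arr_tens arr_comp whiskl // -fusion_unit.
rewrite -!acompA -(@munit_arr _ _ (M ⊗ N) ⌈lift_d d M N⌉) // -amap_arr.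
rewrite (acompA _ _ ⌈fusion _ _⌉) -arr_comp acompA -H.
by rewrite -acompA -arr_comp (proj2 (tens_actP M N)) acompa1.
Qed.

Lemma lift_act_mul M : ρ M ∘ fmap T (ρ M) = ρ M ∘ mmul T (Z M).
Proof.
(* Two passages from an object to its image under T reach [T (T (Z M))], the source of both
   sides. *)
have sep := separating_fusion (separating_fusion (separating_lift_d (M := M))).
apply: (separating_map sep (lift_act_unit M)) => N.
have H := lift_d_act M N.
have lin : (idm N ⊗' mmul T (Z M)) ∘ (fusion N (T (Z M)) ∘ fmap T (fusion N (Z M)))
    = fusion N (Z M) ∘ mmul T (N ⊗ Z M).
  have := fusion_linear N (Z M); rewrite /is_linear /= => ->.
  by rewrite /tens_act /fusion !compA -tensmM comp1m compm1.
(* Using [lift_d_act] twice converts both copies of [ρ M] into actions on [M ⊗ N]. *)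
have d1 : (idm N ⊗' (ρ M ∘ fmap T (ρ M))) ∘ (fusion N (T (Z M))
      ∘ fmap T (fusion N (Z M) ∘ fmap T (lift_d d M N)))
    = lift_d d M N ∘ (tens_act M N ∘ fmap T (tens_act M N)).
  set h := fusion N (Z M) ∘ fmap T (lift_d d M N).
  rewrite -/h in H.
  rewrite -{1}(comp1m (idm N)) tensmM -(compA (idm N ⊗' ρ M)).
  rewrite (compA (idm N ⊗' fmap T (ρ M))) fmap_fusion.
  rewrite -(compA _ (fmap T (idm N ⊗' _))).
  by rewrite -fmapM -H fmapM !(compA (fusion N (Z M))) -/h compA -H -[LHS]compA.
(* The action axiom of [M ⊗ N] leaves one action and μ; [lift_d_act] converts the action back to
   [ρ M], and μ crosses the fusion map by [lin]. *)
rewrite d1 (proj1 (tens_actP M N)) [LHS]compA H.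
rewrite -{2}(comp1m (idm N)) tensmM fmapM -!(compA (idm N ⊗' ρ M)); congr (_ ∘ _).
rewrite (compA (fusion N (T (Z M)))) (compA (idm N ⊗' mmul T (Z M))) lin.
rewrite -!(compA (fusion N (Z M))); congr (_ ∘ _).
exact: (natural (mmul T) (lift_d d M N)).
Qed.

Lemma lift_act_action M : is_action (ρ M).
Proof. by split; [exact: lift_act_mul | exact: lift_act_unit]. Qed.

Lemma lift_d_is_linear (HM : forall M, is_action (ρ M)) : lift_d_linear HM d.
Proof.
move=> M N; rewrite /is_linear [LHS]lift_d_act compA; congr (_ ∘ _).
symmetry; exact: (tens_act_fusion N (lift_mod HM M)).
Qed.

(** Tested on [T (Z M)], the two sides become the two sides of the linearity of [xi N], with
    [lift_d_act] accounting for [ρ M]. *)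
Lemma universal_map_linear M U (r : hom (Z M) U)
    (xi : forall N, hom (M ⊗ N) (N ⊗ U)) :
  (forall N, xi N = (idm N ⊗' r) ∘ lift_d d M N) ->
  (forall N, @is_linear C T (tens_mod M N) (tens_mod N U) (xi N)) ->
  r ∘ ρ M = act U ∘ fmap T r.
Proof.
move=> rP xi_lin; apply: (separating_map (separating_fusion (separating_lift_d (M := M)))
  (proj2 (actP U))) => N.
rewrite -{1}(comp1m (idm N)) tensmM -(compA _ _ (fusion N (Z M) ∘ _)) -lift_d_act.
rewrite -{2}(comp1m (idm N)) tensmM (compA _ (fusion N (Z M))).
rewrite -(compA _ _ (fusion N (Z M))) fmap_fusion.
rewrite (compA (idm N ⊗' act U) (fusion N U)) -tens_act_fusion.
rewrite -[RHS]compA -fmapM -rP compA -rP.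
exact: xi_lin.
Qed.

End Centralizer.

(** * The universal property over the category of modules *)

Theorem theorem6p9 :
  forall (C : AutonomousCategory) (T : HopfMonad C) (Z : Functor C C)
    (d : forall X Y : C, hom (X ⊗ Y) (T Y ⊗ Z X))
    (Om : NatTrans (fcomp T Z) (fcomp Z T)),
  is_centralizer d ->
  is_canonical_law d Om ->
  exists (HM : forall M : Module T, is_action (lift_act Om M))
    (HL : lift_d_linear HM d),
    is_category_centralizer (lift_d_mor HL).
Proof.
move=> C T Z d Om cd law.
exists (lift_act_action cd law), (lift_d_is_linear cd law _); split.
  move=> M M' N N' f g; apply: Linear_eq; rewrite /= /lift_d compA -tensmM.
  rewrite compm1 (lmapP g) -(compA _ (d M' N')) -(centralizer_natural cd) compA.
  by rewrite -tensmM comp1m.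
move=> M W xi nat.
(* The universal property of ∂ needs a family over all objects of [C]: evaluate [xi] at free modules
   and restrict along the unit. *)
pose xi' (Y : C) : hom (carrier M ⊗ Y) (T Y ⊗ carrier W) :=
  lmap (xi (free_mod T Y)) ∘ (idm (carrier M) ⊗' munit T Y).
have nat' (Y Y' : C) (g : hom Y Y') :
    (fmap T g ⊗' idm (carrier W)) ∘ xi' Y = xi' Y' ∘ (idm (carrier M) ⊗' g).
  have := f_equal (@lmap _ _ _ _) (nat _ _ (Build_Linear (fmap_linear T g))).
  rewrite /= /xi' compA => ->.
  by rewrite -!compA -!tensmM (natural (munit T) g).
have [r [rP _]] := centralizer_universal cd nat'.
have r_xi (N : Module T) : lmap (xi N) = (idm (carrier N) ⊗' r) ∘ lift_d d M N.
  have act_lin : @is_linear C T (free_mod T N) N (act N).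
    by rewrite /is_linear /= (proj1 (actP N)).
  have e := f_equal (@lmap _ _ _ _) (nat _ _ (Build_Linear act_lin)); rewrite /= in e.
  (* The linear map [act N] out of the free module on [N] is split in [C] by the unit, so [xi N] is
     determined by the component of [xi] at that free module. *)
  have -> : lmap (xi N) = lmap (xi N) ∘ (idm (carrier M) ⊗' act N)
      ∘ (idm (carrier M) ⊗' munit T N).
    by rewrite -compA -tensmM comp1m (proj2 (actP N)) tensm1 compm1.
  rewrite -e -compA; have := rP N; rewrite /xi' => ->.
  by rewrite /lift_d !compA -!tensmM !comp1m !compm1.
have r_lin := universal_map_linear cd law r_xi (fun N => lmapP (xi N)).
exists (@Build_Linear C T (lift_mod (lift_act_action cd law) M) W r r_lin); split.
  by move=> N; apply: Linear_eq; exact: r_xi.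
move=> r' r'P; apply: Linear_eq; apply: (lift_d_ext cd) => N.
by rewrite /= -r_xi; exact: (f_equal (@lmap _ _ _ _) (r'P N)).
Qed.
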